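(* Let $\mathbf{x}=(x_1,\dots,x_d)$ be generated by an additive noise model over a DAG $\mathcal{G}=(\mathcal{V},\mathcal{E})$, $x_i = f_i(\mathbf{x}_{\mathrm{pa}(i)}) + \epsilon_i$ for $i=1,\dots,d$, where the $\epsilon_i$ are mutually independent with $\epsilon_i\sim\mathcal{N}(0,\sigma^2)$ for a common $\sigma^2>0$, and each $f_i$ is twice continuously differentiable, with all expectations below finite. Let $\mathcal{I}=\mathbb{E}_{p(\mathbf{x})}[-\nabla^2_{\mathbf{x}}\log p(\mathbf{x})]$. Then for every $i$, $$\mathcal{I}_{ii} = \frac{1}{\sigma^2} + \frac{1}{\sigma^2}\sum_{j\in\mathrm{ch}(i)} \mathbb{E}_{p(\mathbf{x})}\!\left[\left(\frac{\partial f_j}{\partial x_i}\right)^2\right].$$ Consequently, if moreover for every edge $j\to i\in\mathcal{E}$ one has $\mathbb{E}_{p(\mathbf{x})}[(\partial f_i/\partial x_j)^2]>0$, then a node $l$ satisfies $\mathcal{I}_{ll}=\min_i \mathcal{I}_{ii} = 1/\sigma^2$ if and only if $l$ is a sink of $\mathcal{G}$ (i.e. $\mathrm{ch}(l)=\emptyset$).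
   Context: $\mathrm{pa}(i)$ and $\mathrm{ch}(i)$ denote the parents and children of node $i$ in the DAG $\mathcal{G}$; $\mathbf{x}_{\mathrm{pa}(i)}$ is the subvector of parent coordinates, and $f_i$ is regarded as a function of all of $\mathbf{x}$ depending only on $\mathbf{x}_{\mathrm{pa}(i)}$ (so $\partial f_j/\partial x_i$ is identically zero unless $i\in\mathrm{pa}(j)$). $p(\mathbf{x})$ is the joint density of $\mathbf{x}$. The matrix $\mathcal{I}$ is called the (expected) Score-Jacobian Information Matrix (SJIM). *)

(* Defs.v *)
From HB Require Import structures.
From mathcomp Require Import all_boot all_order all_algebra.
From mathcomp Require Import all_classical all_reals all_analysis.
Set Implicit Arguments. Unset Strict Implicit. Unset Printing Implicit Defensive.
Import Order.TTheory GRing.Theory Num.Theory.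
Import numFieldNormedType.Exports.
Local Open Scope classical_set_scope.
Local Open Scope ring_scope.

Section ANM.
Variable R : realType.

(** DAG on nodes 'I_d : [adj j i] means there is an edge j -> i
    (j is a parent of i, i is a child of j).  Acyclic: no edge i -> j with
    a directed path back from j to i. *)
Definition acyclic (d : nat) (adj : rel 'I_d) : Prop :=
  forall i j : 'I_d, adj i j -> ~~ connect adj j i.

Definition evec (d : nat) (i : 'I_d) : 'rV[R]_d := delta_mx 0 i.

Definition partial (d : nat) (i : 'I_d) (g : 'rV[R]_d -> R) : 'rV[R]_d -> R :=
  fun x => derive g x (evec i).

Definition C2 (d : nat) (g : 'rV[R]_d -> R) : Prop :=
  [/\ continuous g,
      (forall i x, derivable g x (evec i)),
      (forall i, continuous (partial i g)),
      (forall i j x, derivable (partial j g) x (evec i)) &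
      (forall i j, continuous (partial i (partial j g)))].

Definition depends_only_on_parents (d : nat) (adj : rel 'I_d) (i : 'I_d)
  (g : 'rV[R]_d -> R) : Prop :=
  forall x y : 'rV[R]_d, (forall j, adj j i -> x 0 j = y 0 j) -> g x = g y.

(** iterated Lebesgue integral over R^d (integrating the first coordinate
    outermost); for nonnegative measurable integrands this is the integral
    against d-dimensional Lebesgue measure (Tonelli). *)
Fixpoint iint (n : nat) : ('rV[R]_n -> \bar R) -> \bar R :=
  match n with
  | 0 => fun g => g 0
  | n'.+1 => fun g =>
      (\int[@lebesgue_measure R]_t
         iint (fun y : 'rV[R]_n' => g (row_mx (\row_(_ < 1) t) y)))%E
  end.

Definition rv2t (d : nat) (y : 'rV[R]_d) : d.-tuple R := [tuple y 0 i | i < d].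

(** p is a joint (Lebesgue) density of the random vector X : Omega -> R^d,
    w.r.t. the product (Borel) sigma-algebra on R^d *)
Definition is_joint_density (dT : measure_display) (Omega : measurableType dT)
  (P : probability Omega R) (d : nat) (X : Omega -> 'rV[R]_d)
  (p : 'rV[R]_d -> R) : Prop :=
  (forall y, 0 <= p y) /\
  forall A : set (d.-tuple R), measurable A ->
    P ((fun w => rv2t (X w)) @^-1` A) = iint (fun y => (\1_A (rv2t y) * p y)%:E).

Definition mutually_independent (dT : measure_display) (Omega : measurableType dT)
  (P : probability Omega R) (d : nat) (eps : 'I_d -> Omega -> R) : Prop :=
  forall (S : {set 'I_d}) (B : 'I_d -> set R), (forall i, measurable (B i)) ->
    P (\big[setI/setT]_(i in S) (eps i @^-1` B i)) =
    (\prod_(i in S) P (eps i @^-1` B i))%E.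

(** X ~ N(0, sigma^2) (normal_prob takes the standard deviation) *)
Definition is_centered_normal (dT : measure_display) (Omega : measurableType dT)
  (P : probability Omega R) (X : Omega -> R) (sigma : R) : Prop :=
  forall B : set R, measurable B -> P (X @^-1` B) = normal_prob 0 sigma B.

(** Score-Jacobian Information Matrix  I = E_p[ - Hess_x log p(x) ],
    the expectation under p taken as E_P[ . (X) ] *)
Definition SJIM (dT : measure_display) (Omega : measurableType dT)
  (P : probability Omega R) (d : nat) (X : Omega -> 'rV[R]_d)
  (p : 'rV[R]_d -> R) : 'M[R]_d :=
  \matrix_(i, j) (- Rintegral P setT
       (fun w => partial i (partial j (fun y => ln (p y))) (X w))).

End ANM.

(* Main.v *)
(** Writing [residual y = (y_i - f_i(y))_i], the model says
    [residual (X w) = eps w].  Along a topological order of the DAG, [residual]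
    is a composition of shears [y_i |-> y_i - f_i(y)], so it is a homeomorphism
    preserving Lebesgue measure; comparing continuous densities on cubes gives
    [p y = \prod_i phi_sigma (y_i - f_i(y))] everywhere.  Hence
    [- d_i d_i ln p (X) = sigma^-2 (1 + \sum_(j in ch i) (d_i f_j)^2
      - \sum_j eps_j * d_i d_i f_j)].
    The last sum is integrable, being a combination of integrable functions,
    although its terms need not be.  It has mean zero: flipping the sign of the
    noise of a sink preserves the law of [eps] and changes the sign of the term of
    that sink only, so averaging over the flip discards this term without changing
    the mean; the sum is emptied this way sink after sink. *)
Require Import Defs.
From HB Require Import structures.
From mathcomp Require Import all_boot all_order all_algebra.
From mathcomp Require Import all_classical all_reals all_analysis measurable_realfun.
From mathcomp Require Import ring lra.
Import Order.TTheory GRing.Theory Num.Theory.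
Import numFieldNormedType.Exports.
Local Open Scope classical_set_scope.
Local Open Scope ring_scope.
Set Implicit Arguments.
Unset Strict Implicit.
Unset Printing Implicit Defensive.

(** * Iterated Lebesgue integrals *)

Section iterated_integral.
Variable R : realType.
Notation mu := (@lebesgue_measure R).

(** Row vectors serve for topology and derivatives, tuples for the product sigma-algebra.
    Measurability of a function of a row vector is therefore always stated for its composite with
    this map. *)
Definition t2rv (n : nat) (u : n.-tuple R) : 'rV[R]_n := \row_i tnth u i.

Lemma t2rvK n (y : 'rV[R]_n) : t2rv (rv2t y) = y.
Proof. by apply/rowP => i; rewrite mxE tnth_mktuple. Qed.

Lemma rv2tK n (u : n.-tuple R) : rv2t (t2rv u) = u.
Proof. by apply: eq_from_tnth => i; rewrite tnth_mktuple mxE. Qed.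

(** The body repeats the vector built inside [iint], so that [iintS] holds by conversion. *)
Definition rvcons (n : nat) (t : R) (y : 'rV[R]_n) : 'rV[R]_n.+1 :=
  row_mx (\row_(_ < 1) t) y.

Lemma rvcons0 n t (y : 'rV[R]_n) : rvcons t y 0 ord0 = t.
Proof.
have -> : (ord0 : 'I_n.+1) = lshift n (ord0 : 'I_1) by exact: val_inj.
by apply: etrans (row_mxEl _ _ _ _) _; rewrite mxE.
Qed.

Lemma rvconsS n t (y : 'rV[R]_n) i : rvcons t y 0 (lift ord0 i) = y 0 i.
Proof.
have -> : lift ord0 i = rshift 1 i by exact: val_inj.
exact: row_mxEr.
Qed.

Lemma iintS n (g : 'rV[R]_n.+1 -> \bar R) :
  iint g = (\int[mu]_t iint (fun y => g (rvcons t y)))%E.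
Proof. by []. Qed.

Lemma iint_ge0 n (g : 'rV[R]_n -> \bar R) :
  (forall y, 0 <= g y)%E -> (0 <= iint g)%E.
Proof.
elim: n g => [|n IH] g g0 /=; first exact: g0.
by apply: integral_ge0 => t _; apply: IH.
Qed.

Lemma eq_iint n (g h : 'rV[R]_n -> \bar R) : g =1 h -> iint g = iint h.
Proof. by move=> /funext ->. Qed.

Section parametric.
Context {d : measure_display} {T : measurableType d}.

Definition measurable_rv (n : nat) (u : T -> 'rV[R]_n) :=
  forall i, measurable_fun setT (fun z => u z 0 i).

Lemma measurable_comp_rv n (u : T -> 'rV[R]_n) d' (U : measurableType d')
    (k : 'rV[R]_n -> U) :
  measurable_fun setT (k \o @t2rv n) -> measurable_rv u ->
  measurable_fun setT (fun z => k (u z)).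
Proof.
move=> mk mu_; rewrite (_ : (fun z => _) = (k \o @t2rv n) \o (@rv2t R n \o u)).
  apply: measurableT_comp => //; apply/measurable_fun_tnthP => i.
  rewrite (_ : _ \o _ = fun z => u z 0 i)//.
  by apply/funext => z /=; rewrite tnth_mktuple.
by apply/funext => z /=; rewrite t2rvK.
Qed.

End parametric.

Lemma measurable_t2rv n : measurable_rv (@t2rv n).
Proof.
move=> i; rewrite (_ : (fun z => _) = (@tnth n R)^~ i); first exact: measurable_tnth.
by apply/funext => u; rewrite mxE.
Qed.

(** Joint measurability in a parameter and a vector. Unfolding [iint] once turns the outer
    coordinate into a parameter, so inductions on the dimension replace [T] by [T * R]. *)
Definition measurable_param {d : measure_display} {T : measurableType d} (n : nat)
  (h : T -> 'rV[R]_n -> \bar R) :=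
  measurable_fun setT (fun z : T * n.-tuple R => h z.1 (t2rv z.2)).

Lemma measurable_param_comp {d d' : measure_display} {T : measurableType d}
   {U : measurableType d'} n (h : T -> 'rV[R]_n -> \bar R) (a : U -> T)
   (u : U -> 'rV[R]_n) :
  measurable_param h -> measurable_fun setT a -> measurable_rv u ->
  measurable_fun setT (fun z => h (a z) (u z)).
Proof.
move=> mh ma mu_.
rewrite (_ : (fun z => _) = (fun z : T * n.-tuple R => h z.1 (t2rv z.2)) \o
   (fun z => (a z, rv2t (u z)))); last first.
  by apply/funext => z /=; rewrite t2rvK.
apply: measurableT_comp => //; apply/measurable_fun_pair => //=.
apply/measurable_fun_tnthP => i.
rewrite (_ : _ \o _ = fun z => u z 0 i)//.
by apply/funext => z /=; rewrite tnth_mktuple.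
Qed.

Lemma measurable_rvcons {d} {T : measurableType d} n (a : T -> R)
    (u : T -> 'rV[R]_n) : measurable_fun setT a -> measurable_rv u ->
  measurable_rv (fun z => rvcons (a z) (u z)).
Proof.
move=> ma mu_ i; case: (unliftP ord0 i) => [j ->|->].
  by under eq_fun do rewrite rvconsS; exact: mu_.
by under eq_fun do rewrite rvcons0; exact: ma.
Qed.

Lemma measurable_rv_t2rv_comp {d} {T : measurableType d} n (v : T -> n.-tuple R) :
  measurable_fun setT v -> measurable_rv (fun z => t2rv (v z)).
Proof.
move=> mv i; have := measurableT_comp (measurable_tnth i) mv.
by congr measurable_fun; apply/funext => z /=; rewrite mxE.
Qed.

Lemma measurable_param_rvcons {d} {T : measurableType d} n
    (h : T -> 'rV[R]_n.+1 -> \bar R) :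
  measurable_param h ->
  measurable_param (fun (z : T * R) y => h z.1 (rvcons z.2 y)).
Proof.
move=> mh; apply: (measurable_param_comp mh) => /=.
  exact: (measurableT_comp measurable_fst measurable_fst).
apply: measurable_rvcons.
  exact: (measurableT_comp measurable_snd measurable_fst).
apply: measurable_rv_t2rv_comp; exact: measurable_snd.
Qed.

Lemma measurable_iint {d} {T : measurableType d} n (h : T -> 'rV[R]_n -> \bar R) :
  (forall t y, 0 <= h t y)%E -> measurable_param h ->
  measurable_fun setT (fun t => iint (h t)).
Proof.
elim: n d T h => [|n IH] d T h h0 mh /=.
  by apply: (measurable_param_comp mh) => // -[].
have := IH _ _ (fun (z : T * R) y => h z.1 (rvcons z.2 y)).
move=> /(_ (fun _ _ => h0 _ _) (measurable_param_rvcons mh)) m1.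
apply: (measurable_fun_fubini_tonelli_F (m2 := mu) _ m1) => -[t s].
by apply: iint_ge0.
Qed.

(** The extra variable is moved past one coordinate at a time, each exchange being the two-variable
    Tonelli theorem for the integral [k] over the remaining coordinates. *)
Lemma iint_tonelli n (h : R -> 'rV[R]_n -> \bar R) :
  (forall t y, 0 <= h t y)%E -> measurable_param h ->
  (\int[mu]_t iint (h t) = iint (fun y => \int[mu]_t h t y))%E.
Proof.
elim: n h => [|n IH] h h0 mh //=.
pose k (z : R * R) := iint (fun y => h z.1 (rvcons z.2 y)).
have mk : measurable_fun setT k.
  by apply: measurable_iint => [? ?|]; [exact: h0|exact: measurable_param_rvcons].
have k0 z : (0 <= k z)%E by exact: iint_ge0.
have /= -> := fubini_tonelli (m1 := mu) (m2 := mu) _ mk k0.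
apply: eq_integral => s _; rewrite /k /=; apply: IH => //.
apply: (measurable_param_comp mh) => //=.
by apply: measurable_rvcons => //; apply: measurable_rv_t2rv_comp.
Qed.

Definition upd n (i : 'I_n) (s : R) (y : 'rV[R]_n) : 'rV[R]_n :=
  \row_j if j == i then s else y 0 j.

Lemma upd_rvcons0 n s t (y : 'rV[R]_n) : upd ord0 s (rvcons t y) = rvcons s y.
Proof.
apply/rowP => j; rewrite mxE; case: (unliftP ord0 j) => [k ->|->].
  by rewrite !rvconsS.
by rewrite eqxx rvcons0.
Qed.

Lemma upd_rvconsS n i s t (y : 'rV[R]_n) :
  upd (lift ord0 i) s (rvcons t y) = rvcons t (upd i s y).
Proof.
apply/rowP => j; rewrite mxE; case: (unliftP ord0 j) => [k ->|->].
  by rewrite !rvconsS (inj_eq lift_inj) mxE.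
by rewrite !rvcons0.
Qed.

(** Stated through integrals of nonnegative functions, the form in which it is substituted inside
    [iint]. *)
Definition lebesgue_preserving (g : R -> R) :=
  forall k : R -> \bar R, (forall t, 0 <= k t)%E -> measurable_fun setT k ->
  (\int[mu]_t k (g t) = \int[mu]_t k t)%E.

(** Only coordinate [i] moves, along lines on which Lebesgue measure is preserved. If [i] is not the
    outermost coordinate, the claim passes under the outer integral; if it is, Tonelli brings its
    integral innermost, where the hypothesis on lines applies. *)
Lemma iint_upd n (i : 'I_n) (phi : 'rV[R]_n -> R) (h : 'rV[R]_n -> \bar R) :
  (forall y, 0 <= h y)%E -> measurable_fun setT (h \o @t2rv n) ->
  measurable_fun setT (phi \o @t2rv n) ->
  (forall y, lebesgue_preserving (fun t => phi (upd i t y))) ->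
  iint (fun y => h (upd i (phi y) y)) = iint h.
Proof.
elim: n i phi h => [[]//|n IH] i phi h h0 mh mphi pres.
rewrite !iintS; case: (unliftP ord0 i) pres => [j ->|->] pres.
  apply: eq_integral => t _; under eq_iint do rewrite upd_rvconsS.
  apply: (IH j (fun y => phi (rvcons t y)) (fun y => h (rvcons t y))) => //.
  - apply: (measurable_comp_rv mh) => //=; apply: measurable_rvcons => //.
    exact: measurable_t2rv.
  - apply: (measurable_comp_rv mphi) => //=; apply: measurable_rvcons => //.
    exact: measurable_t2rv.
  - by move=> y; under eq_fun do rewrite -upd_rvconsS; exact: pres.
under eq_integral do under eq_iint do rewrite upd_rvcons0.
rewrite (@iint_tonelli _ (fun t y => h (rvcons (phi (rvcons t y)) y))) //; last first.
  apply: (measurable_comp_rv mh); apply: measurable_rvcons.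
    apply: (measurable_comp_rv mphi); apply: measurable_rvcons => //.
    exact: measurable_rv_t2rv_comp.
  exact: measurable_rv_t2rv_comp.
rewrite (@iint_tonelli _ (fun t y => h (rvcons t y))) //; last first.
  apply: (measurable_comp_rv mh); apply: measurable_rvcons => //.
  exact: measurable_rv_t2rv_comp.
apply: eq_iint => y.
(* The entry 0 is a placeholder, overwritten by [upd ord0]. *)
have := pres (rvcons 0 y) (fun s => h (rvcons s y)).
under eq_integral do rewrite upd_rvcons0.
apply => //; apply: (measurable_comp_rv mh); apply: measurable_rvcons => // k.
Qed.

End iterated_integral.

(** * Measure-preserving maps of the line, integrals of products, and measurability of open sets *)

Section lebesgue_measure_facts.
Variable R : realType.
Notation mu := (@lebesgue_measure R).

(** The pushforward of Lebesgue measure along [g] agrees with it on half-open intervals, hence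
    equals it by uniqueness. *)
Lemma lebesgue_preserving_itv (g : R -> R) : measurable_fun setT g ->
  (forall a b, a < b -> mu (g @^-1` `]a, b]) = (b - a)%:E) -> lebesgue_preserving g.
Proof.
move=> mg gab k k0 mk.
have mg' : measurable_fun (T := measurableTypeR R) (U := measurableTypeR R) setT g.
  exact: mg.
pose nu := measure_function_pushforward__canonical__measure_function_Measure mu mg'.
have nuE (A : set (measurableTypeR R)) : measurable A -> mu A = nu A.
  apply: (lebesgue_measure_unique (mu := nu)) => _ [[a b] _ <-] /=.
  rewrite lebesgue_measure_itv /= lte_fin; case: ltP => [ab|ba].
    by rewrite /pushforward gab // EFinB.
  by rewrite set_itv_ge ?bnd_simp -?leNgt// measure0.
rewrite [RHS](eq_measure_integral nu) => [|A mA _]; last exact: nuE.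
by rewrite [RHS](ge0_integral_pushforward mg') // preimage_setT.
Qed.

Lemma lebesgue_preserving_shift (c : R) : lebesgue_preserving (fun t => t + c).
Proof.
apply: lebesgue_preserving_itv => [|a b ab].
  by apply: measurable_funD => //; exact: measurable_cst.
rewrite (_ : _ @^-1` _ = `]a - c, b - c]%classic).
  rewrite lebesgue_measure_itv /= lte_fin ltrD2r ab -EFinB.
  by congr (_%:E); rewrite opprB addrA subrK.
by apply/seteqP; split=> x /=; rewrite !in_itv /= ltrBlDr lerBrDr.
Qed.

Lemma lebesgue_preserving_opp : lebesgue_preserving (fun t : R => - t).
Proof.
apply: lebesgue_preserving_itv => [|a b ab]; first exact: measurable_funN.
rewrite (_ : _ @^-1` _ = `[- b, - a[%classic).
  by rewrite lebesgue_measure_itv /= lte_fin ltrN2 ab -EFinB opprK addrC.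
by apply/seteqP; split=> x /=; rewrite !in_itv /= ltrNr lerNl andbC.
Qed.

(** The constant [k] makes the induction work: it absorbs the factor of the outer coordinate, which
    is constant for the inner integrals. *)
Lemma iint_prod n (g : 'I_n -> R -> R) (k : R) : 0 <= k ->
  (forall i, measurable_fun setT (g i)) -> (forall i t, 0 <= g i t) ->
  iint (fun y : 'rV[R]_n => (k * \prod_i g i (y 0 i))%:E) =
  (k%:E * \prod_i \int[mu]_t (g i t)%:E)%E.
Proof.
elim: n g k => [|n IH] g k k0 mg g0.
  by rewrite /= !big_ord0 mulr1 mule1.
rewrite iintS big_ord_recl muleA.
under eq_integral => t _.
  under eq_iint => y do rewrite big_ord_recl rvcons0 mulrA.
  under eq_iint => y do under eq_bigr => i _ do rewrite rvconsS.
  rewrite (IH (fun i => g (lift ord0 i)) (k * g ord0 t)) ?mulr_ge0//.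
  rewrite EFinM -muleA [(_ * \prod_(i < n) _)%E]muleC muleA.
  over.
set c := (\prod_(i < n) _)%E.
have c0 : (0 <= c)%E.
  rewrite /c; elim/big_ind : _ => // [? ? ? ?|i _]; [exact: mule_ge0|].
  by apply: integral_ge0 => t _; rewrite lee_fin.
rewrite ge0_integralZl//.
- by rewrite -!muleA; congr (_ * _)%E; exact: muleC.
- by apply/measurable_EFinP; exact: mg.
- by move=> t _; rewrite lee_fin.
- by rewrite mule_ge0.
Qed.

(** The integral of a nonnegative function is a supremum over the simple functions below it, so
    monotonicity is an inclusion of index sets and covers arbitrary integrands. *)
Lemma le_iint n (g h : 'rV[R]_n -> \bar R) :
  (forall y, 0 <= g y)%E -> (forall y, g y <= h y)%E -> (iint g <= iint h)%E.
Proof.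
elim: n g h => [|n IH] g h g0 gh /=; first exact: gh.
have g1 t : (0 <= iint (fun y => g (rvcons t y)))%E by exact: iint_ge0.
have gh1 t : (iint (fun y => g (rvcons t y)) <= iint (fun y => h (rvcons t y)))%E.
  exact: IH.
rewrite !ge0_integralTE//; last by move=> t; apply: le_trans (gh1 t).
apply: le_ereal_sup => _ /= [s sg <-]; exists s => // t.
exact: le_trans (sg t) (gh1 t).
Qed.

(** An open set is the union of the countably many rational cubes that it contains, and cubes are
    finite intersections of coordinate preimages. *)
Lemma open_measurable_rV n (U : set 'rV[R]_n) : open U ->
  measurable (@t2rv R n @^-1` U).
Proof.
move=> oU.
(* The radius is 1/(m+1); the successor excludes the inverse of 0, which is 0. *)
pose B (cm : {ffun 'I_n -> rat} * nat) : set 'rV[R]_n :=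
  [set y | forall i, `|ratr (cm.1 i) - y 0 i| < cm.2.+1%:R^-1].
have -> : U = \bigcup_(cm in [set cm | B cm `<=` U]) B cm.
  apply/seteqP; split => [y Uy|y [cm /= BU]]; last exact: BU.
  have /nbhs_ballP [e e0 eU] : nbhs y U by exact: open_nbhs_nbhs.
  (* Half of [e], because [y] and any other point of the cube are compared through the rational
     centre. *)
  have [m me] : exists m : nat, m.+1%:R^-1 < e / 2.
    have [m _ mP] := near_infty_natSinv_lt (PosNum (divr_gt0 e0 (ltr0n R 2))).
    by exists m; exact: mP (leqnn m).
  have /choice [c cP] : forall i, exists q : rat, `|ratr q - y 0 i| < m.+1%:R^-1.
    move=> i; have := @rat_in_itvoo R (y 0 i - m.+1%:R^-1) (y 0 i + m.+1%:R^-1).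
    have m0 : 0 < m.+1%:R^-1 :> R by rewrite invr_gt0.
    move=> [|q]; first by rewrite ltrD2l gtrN.
    by rewrite in_itv /= => qP; exists q; rewrite ltr_distl.
  exists (finfun c, m); last by move=> i /=; rewrite ffunE.
  move=> z Bz; apply: eU; split=> // i j; rewrite (ord1 i) /ball /=.
  have := Bz j; rewrite /= ffunE => zj.
  rewrite (_ : y 0 j - z 0 j = (ratr (c j) - z 0 j) - (ratr (c j) - y 0 j)); last first.
    by rewrite opprB [RHS]addrC addrA subrK.
  apply: le_lt_trans (ler_normB _ _) _; rewrite [e]splitr.
  by apply: ltrD; [exact: lt_trans zj me|exact: lt_trans (cP j) me].
rewrite bigcup_mkcond preimage_bigcup.
apply: countable_bigcupT_measurable => [|cm]; first exact: countableP.
case: ifPn => _; last by rewrite preimage_set0; exact: measurable0.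
rewrite (_ : _ @^-1` _ = \bigcap_(i in [set: 'I_n])
   (@tnth n R ^~ i @^-1` [set t | `|ratr (cm.1 i) - t| < cm.2.+1%:R^-1])).
  apply: fin_bigcap_measurable => [|i _]; first exact: finite_finset.
  rewrite -[X in measurable X]setTI; apply: measurable_tnth => //.
  by apply: open_measurable; apply: (@ball_open R R^o); rewrite /= invr_gt0.
apply/seteqP; split => [u /= Bu i _|u /= Bu i].
  by have := Bu i; rewrite mxE.
by rewrite mxE; apply: Bu.
Qed.

Lemma continuous_measurable_rV n (g : 'rV[R]_n -> R) : continuous g ->
  measurable_fun setT (g \o @t2rv R n).
Proof.
move=> /continuousP cg.
apply: (measurability _ (RGenOpens.measurableE R)).
move=> _ [_ [a [b ->] <-]].
rewrite setTI comp_preimage; apply: open_measurable_rV; apply: cg.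
exact: interval_open.
Qed.

End lebesgue_measure_facts.

(** * Residual map of the model *)

Section dag_induction.
Variables (d : nat) (adj : rel 'I_d).

(** These are the ancestral sets of nodes. Removing a sink of such a set leaves another one. *)
Definition parent_closed (S : {set 'I_d}) :=
  forall i j, adj j i -> i \in S -> j \in S.

Lemma parent_closedT : parent_closed finset.setT.
Proof. by move=> i j _ _; rewrite finset.in_setT. Qed.

Hypothesis acyc : acyclic adj.

Lemma acyclic_loopless i : ~~ adj i i.
Proof. by apply/negP => /[dup] /acyc; rewrite connect0. Qed.

Definition ancestors (i : 'I_d) := [pred j | connect adj j i].

(** The inclusion is strict because [j] counts among its own ancestors and, by acyclicity, not among
    those of [i]. *)
Lemma ltn_ancestors i j : adj i j -> (#|ancestors i| < #|ancestors j|)%N.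
Proof.
move=> ij; apply: proper_card; apply/properP; split.
  by apply/fintype.subsetP => k; rewrite !inE => /connect_trans; apply; exact: connect1.
by exists j; rewrite !inE ?connect0//; exact: acyc.
Qed.

(** This replaces a topological order. A node of [S] with the most ancestors has no child in [S],
    since a child would have more; it may well have children outside [S]. *)
Lemma sink_ind (Q : {set 'I_d} -> Prop) : Q finset.set0 ->
  (forall (S : {set 'I_d}) i, parent_closed S -> i \in S ->
    (forall j, j \in S -> ~~ adj i j) ->
    Q (S :\ i) -> Q S) ->
  forall S, parent_closed S -> Q S.
Proof.
move=> Q0 QS S; have [n] := ubnP #|S|; elim: n S => // n IH S Sn pS.
have [->//|[i0 i0S]] := set_0Vmem S.
have [i iS0 imax] := arg_maxnP (fun i => #|ancestors i|) i0S.
have {iS0} iS : i \in S by exact: iS0.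
have sink j : j \in S -> ~~ adj i j.
  by move=> /imax /=; rewrite leqNgt; apply: contra => /ltn_ancestors.
apply: (QS S i) => //; apply: IH.
  by move: Sn; rewrite (cardsD1 i) iS.
move=> j k kj; rewrite !in_setD1 => /andP[ji jS]; rewrite (pS _ _ kj jS) andbT.
by apply: contraTneq kj => ->; exact: sink.
Qed.

End dag_induction.

Section residual_map.
Variables (R : realType) (d : nat) (adj : rel 'I_d) (f : 'I_d -> 'rV[R]_d -> R).
Hypothesis acyc : acyclic adj.
Hypothesis dep : forall i, depends_only_on_parents adj i (f i).
Hypothesis cf : forall i, continuous (f i).

Lemma depends_upd (j i : 'I_d) (g : 'rV[R]_d -> R) s y :
  depends_only_on_parents adj j g -> ~~ adj i j -> g (upd i s y) = g y.
Proof.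
move=> dg nij; apply: dg => k kj; rewrite mxE; case: eqP => // ki.
by rewrite ki (negbTE nij) in kj.
Qed.

Lemma upd_id n (i : 'I_n) (y : 'rV[R]_n) : upd i (y 0 i) y = y.
Proof. by apply/rowP => j; rewrite mxE; case: eqP => [->|]. Qed.

Lemma updE n (i : 'I_n) s (y : 'rV[R]_n) : upd i s y 0 i = s.
Proof. by rewrite mxE eqxx. Qed.

Lemma upd_upd n (i : 'I_n) s t (y : 'rV[R]_n) : upd i s (upd i t y) = upd i s y.
Proof. by apply/rowP => j; rewrite !mxE; case: eqP. Qed.

Lemma continuous_rV (T : topologicalType) n (u : T -> 'rV[R]_n) :
  (forall i, continuous (fun z => u z 0 i)) -> continuous u.
Proof.
move=> cu z A /= [B nB BA]; apply: (filterS (P := [set z' | forall i, B 0 i (u z' 0 i)])).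
  by move=> z' Bz' /=; apply: BA => i j; rewrite (ord1 i).
apply: (@filter_forall _ _ (fun i z' => B 0 i (u z' 0 i)) (nbhs z)) => i.
exact: (cu i z (B 0 i) (nB 0 i)).
Qed.

Lemma continuous_rv_measurable n m (u : 'rV[R]_n -> 'rV[R]_m) : continuous u ->
  measurable_rv (u \o @t2rv R n).
Proof.
move=> cu i; apply: (@continuous_measurable_rV R n (fun y => u y 0 i)) => y.
apply: (@continuous_comp _ _ _ u (fun z : 'rV[R]_m => z 0 i)); first exact: cu.
exact: coord_continuous.
Qed.

Lemma continuous_upd n (i : 'I_n) (phi : 'rV[R]_n -> R) : continuous phi ->
  continuous (fun y => upd i (phi y) y).
Proof.
move=> cphi; apply: continuous_rV => j; under eq_fun do rewrite mxE.
by case: eqP => // _; exact: coord_continuous.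
Qed.

(** The set [S] interpolates between the identity ([S] empty) and the map recovering the noise from
    the state ([S] full), so that [sink_ind] applies. *)
Definition residual (S : {set 'I_d}) (y : 'rV[R]_d) : 'rV[R]_d :=
  \row_i (y 0 i - if i \in S then f i y else 0).

(** No [f j] with [j] in [S] sees coordinate [i], so the residual at [i] can be taken first without
    disturbing the others. *)
Lemma residual_sink (S : {set 'I_d}) i y : i \in S ->
  (forall j, j \in S -> ~~ adj i j) ->
  residual S y = residual (S :\ i) (upd i (y 0 i - f i y) y).
Proof.
move=> iS sink; apply/rowP => j; rewrite !mxE in_setD1.
have [->|ji] /= := eqVneq j i; first by rewrite iS subr0.
by case: ifP => // jS; rewrite (depends_upd _ _ (@dep j))// sink.
Qed.

Lemma continuous_residual S : continuous (residual S).
Proof.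
apply: continuous_rV => i; under eq_fun do rewrite mxE.
move=> y; apply: continuousB; first exact: coord_continuous.
by case: (i \in S); [exact: cf|exact: cst_continuous].
Qed.

(* Removing a sink factors the residual map through the shear
   [y_i |-> y_i - f_i(y)], which preserves Lebesgue measure since [f_i] does
   not involve [y_i]. *)
Lemma iint_residual (S : {set 'I_d}) (h : 'rV[R]_d -> \bar R) :
  (forall y, 0 <= h y)%E -> measurable_fun setT (h \o @t2rv R d) ->
  parent_closed adj S -> iint (h \o residual S) = iint h.
Proof.
move=> h0 mh pS; move: S pS; apply: (sink_ind acyc) => [|S i _ iS sink IH].
  apply: eq_iint => y /=; congr h.
  by apply/rowP => i; rewrite mxE finset.in_set0 subr0.
rewrite -[RHS]IH -(@iint_upd _ _ i (fun y => y 0 i - f i y) (h \o residual (S :\ i))) //.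
- by apply: eq_iint => y /=; rewrite (residual_sink _ iS sink).
- by move=> y; exact: h0.
- exact: (measurable_comp_rv mh (continuous_rv_measurable (@continuous_residual (S :\ i)))).
- apply: continuous_measurable_rV => y.
  by apply: continuousB; [exact: coord_continuous|exact: cf].
- move=> y; under eq_fun do rewrite updE (depends_upd _ _ (@dep i)) ?acyclic_loopless//.
  exact: lebesgue_preserving_shift.
Qed.

(** The inverse for [S :\ i] is followed by the opposite shear, adding [f i] to coordinate [i]; it
    undoes the first shear because [f i] does not see that coordinate. *)
Lemma residual_inverse (S : {set 'I_d}) : parent_closed adj S ->
  exists Phi : 'rV[R]_d -> 'rV[R]_d,
    [/\ continuous Phi, cancel Phi (residual S) & cancel (residual S) Phi].
Proof.
move: S; apply: (sink_ind acyc) => [|S i _ iS sink [Phi [cPhi PhiK resK]]].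
  exists id; split=> y; first exact: cvg_id.
    by apply/rowP => i; rewrite mxE finset.in_set0 subr0.
  by apply/rowP => i; rewrite mxE finset.in_set0 subr0.
have fi s y : f i (upd i s y) = f i y.
  exact: depends_upd (@dep i) (acyclic_loopless acyc i).
exists (fun e => upd i (Phi e 0 i + f i (Phi e)) (Phi e)); split.
- move=> e; apply: (@continuous_comp _ _ _ Phi (fun y => upd i (y 0 i + f i y) y)).
    exact: cPhi.
  apply: continuous_upd => y.
  by apply: continuousD; [exact: coord_continuous|exact: cf].
- by move=> e; rewrite (residual_sink _ iS sink) updE fi upd_upd addrK upd_id PhiK.
- by move=> y; rewrite (residual_sink _ iS sink) resK updE fi upd_upd subrK upd_id.
Qed.

Variable Phi : 'rV[R]_d -> 'rV[R]_d.
Hypothesis PhiK : cancel Phi (residual finset.setT).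

(** The structural equation: [Phi e] is the state generated by the noise [e]. *)
Lemma residual_invE e i : Phi e 0 i = e 0 i + f i (Phi e).
Proof. by rewrite -{2}(PhiK e) mxE finset.in_setT subrK. Qed.

(** The noise of a sink of [S] influences no other node of [S]. By induction on the number of
    ancestors: the parents of [j] are again in [S :\ i]. *)
Lemma residual_inv_upd (S : {set 'I_d}) i s e j : parent_closed adj S ->
  (forall j, j \in S -> ~~ adj i j) -> j \in S :\ i ->
  Phi (upd i s e) 0 j = Phi e 0 j.
Proof.
move=> pS sink; have [n] := ubnP #|ancestors adj j|; elim: n j => // n IH j jn.
rewrite in_setD1 => /andP[ji jS].
rewrite !residual_invE mxE (negbTE ji); congr (_ + _); apply: dep => k kj.
apply: IH; first by apply: leq_trans (ltn_ancestors acyc kj) _; rewrite -ltnS.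
rewrite in_setD1 (pS _ _ kj jS) andbT.
by apply: contraTneq kj => ->; exact: sink.
Qed.

End residual_map.

(** * Density and symmetry of the noise *)

Section cubes.
Variable R : realType.
Notation mu := (@lebesgue_measure R).

Lemma indic_iff T U (A : set T) (B : set U) x y : (A x <-> B y) ->
  \1_A x = \1_B y :> R.
Proof.
by move=> [AB BA]; rewrite !indicE; congr (nat_of_bool _)%:R;
  apply/idP/idP => /set_mem; [move/AB|move/BA]; exact: mem_set.
Qed.

Lemma continuous_bigprod (T : topologicalType) (I : Type) (s : seq I)
    (g : I -> T -> R) : (forall i, continuous (g i)) ->
  continuous (fun x => \prod_(i <- s) g i x).
Proof.
move=> cg; elim: s => [|i s IH].
  by under eq_fun do rewrite big_nil; exact: cst_continuous.
by under eq_fun do rewrite big_cons; move=> x; apply: continuousM; [exact: cg|exact: IH].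
Qed.

Definition cube n (c : 'rV[R]_n) (e : R) : set 'rV[R]_n :=
  [set y | forall i, `]c 0 i - e, c 0 i + e[%classic (y 0 i)].

Lemma indic_cube n (c : 'rV[R]_n) e y :
  \1_(cube c e) y = \prod_i \1_(`]c 0 i - e, c 0 i + e[%classic) (y 0 i) :> R.
Proof.
rewrite indicE; case: (boolP (y \in cube c e)) => [/set_mem cy|ncy] /=.
  by rewrite big1// => i _; rewrite indicE mem_set//; exact: cy.
have [i ni] : exists i, ~ `]c 0 i - e, c 0 i + e[%classic (y 0 i).
  by apply/existsNP => cy; move/negP: ncy; apply; exact/mem_set.
by rewrite (bigD1 i)//= indicE memNset// mul0r.
Qed.

Lemma measurable_cube n (c : 'rV[R]_n) e : measurable (@t2rv R n @^-1` cube c e).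
Proof.
rewrite (_ : _ @^-1` _ = \bigcap_(i in [set: 'I_n])
   (@tnth n R ^~ i @^-1` `]c 0 i - e, c 0 i + e[%classic)).
  apply: fin_bigcap_measurable => [|i _]; first exact: finite_finset.
  rewrite -[X in measurable X]setTI; exact: measurable_tnth.
apply/seteqP; split => [u /= Bu i _|u /= Bu i].
  by have := Bu i; rewrite mxE.
by rewrite mxE; apply: Bu.
Qed.

Lemma iint_cube n (c : 'rV[R]_n) (e k : R) : 0 < e -> 0 <= k ->
  iint (fun y => (k * \1_(cube c e) y)%:E) = (k * (e *+ 2) ^+ n)%:E.
Proof.
move=> e0 k0; under eq_iint do rewrite indic_cube.
rewrite (iint_prod (g := fun i => \1_(`]c 0 i - e, c 0 i + e[%classic)))//.
rewrite (eq_bigr (fun=> (e *+ 2)%:E)) => [|i _].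
  by rewrite prodEFin prodr_const card_ord -EFinM.
rewrite integral_indic// setIT.
apply: (etrans (lebesgue_measure_itv `]c 0 i - e, c 0 i + e[)).
rewrite /= lte_fin.
rewrite ltrD2l gtrN// -EFinB; congr _%:E; ring.
Qed.

Lemma cube_ball n (c : 'rV[R]_n) e : 0 < e -> cube c e `<=` ball c e.
Proof.
move=> e0 y cy; split=> // i j; rewrite (ord1 i) /ball /= distrC ltr_distl.
by have := cy j; rewrite /= in_itv.
Qed.

(** If [r c < q c], two levels [a < b] separate the functions on a small cube around [c], and then
    also their integrals over it. Used in both directions, this gives equality at every point. *)
Lemma continuous_le_of_cubes n (r q : 'rV[R]_n -> R) c :
  continuous r -> continuous q -> (forall y, 0 <= r y) ->
  (forall e, 0 < e -> iint (fun y => (\1_(cube c e) y * r y)%:E) =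
                      iint (fun y => (\1_(cube c e) y * q y)%:E)) ->
  q c <= r c.
Proof.
move=> cr cq r0 rq; rewrite leNgt; apply/negP => rqc.
(* The points cutting the interval from [r c] to [q c] into thirds. *)
pose a := (r c *+ 2 + q c) / 3; pose b := (r c + q c *+ 2) / 3.
have ra : r c < a by rewrite /a; lra.
have ab : a < b by rewrite /a /b; lra.
have bq : b < q c by rewrite /b; lra.
have a0 : 0 <= a by rewrite (le_trans (r0 c))// ltW.
have : nbhs c [set y | r y < a /\ b < q y].
  apply: filterI; [exact: (cr c _ (lt_nbhsl ra))|].
  exact: (cq c _ (lt_nbhsr bq)).
move=> /nbhs_ballP[e /= e0 eP].
have H1 : (iint (fun y => (\1_(cube c e) y * r y)%:E) <= (a * (e *+ 2) ^+ n)%:E)%E.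
  rewrite -(iint_cube c e0 a0); apply: le_iint => y; first by rewrite lee_fin mulr_ge0.
  rewrite lee_fin indicE; case: (boolP (y \in _)) => [/set_mem cy|_].
    by rewrite mul1r mulr1; have [/ltW] := eP _ (cube_ball e0 cy).
  by rewrite mul0r mulr0.
have H2 : ((b * (e *+ 2) ^+ n)%:E <= iint (fun y => (\1_(cube c e) y * q y)%:E))%E.
  rewrite -(iint_cube c e0 (ltW (le_lt_trans a0 ab))).
  apply: le_iint => y; first by rewrite lee_fin mulr_ge0// ltW// (le_lt_trans a0 ab).
  rewrite lee_fin indicE; case: (boolP (y \in _)) => [/set_mem cy|_].
    by rewrite mul1r mulr1; have [_ /ltW] := eP _ (cube_ball e0 cy).
  by rewrite mul0r mulr0.
rewrite rq// in H1; have := le_trans H2 H1; rewrite lee_fin ler_pM2r.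
  by rewrite leNgt ab.
by rewrite exprn_gt0// mulrn_wgt0.
Qed.

End cubes.

(** * Law and density of the noise vector *)

Section noise_law.
Variables (R : realType) (dT : measure_display) (Omega : measurableType dT).
Variables (P : probability Omega R) (d : nat) (adj : rel 'I_d).
Variables (f : 'I_d -> 'rV[R]_d -> R) (eps : 'I_d -> Omega -> R).
Variables (X : Omega -> 'rV[R]_d) (sigma : R) (p : 'rV[R]_d -> R).
Variable Phi : 'rV[R]_d -> 'rV[R]_d.
Hypothesis acyc : acyclic adj.
Hypothesis dep : forall i, depends_only_on_parents adj i (f i).
Hypothesis cf : forall i, continuous (f i).
Hypothesis sigma_neq0 : sigma != 0.
Hypothesis indep : mutually_independent P eps.
Hypothesis normal : forall i, is_centered_normal P (eps i) sigma.
Hypothesis XE : forall w, residual f finset.setT (X w) = \row_i eps i w.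
Hypothesis dens : is_joint_density P X p.
Hypothesis cp : continuous p.
Hypothesis cPhi : continuous Phi.
Hypothesis resK : cancel (residual f finset.setT) Phi.

Definition noise (w : Omega) : d.-tuple R := [tuple eps i w | i < d].

Let p_ge0 : forall y, 0 <= p y. Proof. by case: dens. Qed.

(** Change of variables with unit Jacobian: the noise has density [p \o Phi]. The event is pulled
    back to one about [X], whose density is [p]. *)
Lemma noise_law (B : set (d.-tuple R)) : measurable B ->
  P (noise @^-1` B) = iint (fun e => (\1_B (rv2t e) * p (Phi e))%:E).
Proof.
move=> mB.
pose A := (@rv2t R d \o residual f finset.setT \o @t2rv R d) @^-1` B.
have mres : measurable_fun setT (@rv2t R d \o residual f finset.setT \o @t2rv R d).
  apply/measurable_fun_tnthP => i.
  have := continuous_rv_measurable (continuous_residual (S := finset.setT) cf) i.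
  by congr measurable_fun; apply/funext => u /=; rewrite tnth_mktuple.
have mA : measurable A by rewrite -[A]setTI; exact: mres.
have [_ /(_ A mA)] := dens.
rewrite (_ : _ @^-1` A = noise @^-1` B); last first.
  apply/seteqP; rewrite /A /preimage /=; split=> w /=; rewrite t2rvK XE.
    by congr B; apply: eq_from_tnth => i; rewrite !tnth_mktuple mxE.
  by congr B; apply: eq_from_tnth => i; rewrite !tnth_mktuple mxE.
move=> ->.
(* Substitution of [e] by the residual of [y], after which [Phi e] is [y]. *)
rewrite -[RHS](@iint_residual R d adj f acyc dep cf finset.setT); last 3 first.
- by move=> e; rewrite lee_fin mulr_ge0.
- apply/measurable_EFinP; apply: measurable_funM.
    rewrite (_ : (fun _ => _) = \1_B); first exact: measurable_indic.
    by apply/funext => u /=; rewrite rv2tK.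
  apply: (@continuous_measurable_rV R d (p \o Phi)) => e.
  by apply: continuous_comp; [exact: cPhi|exact: cp].
- exact: parent_closedT.
apply: eq_iint => y /=; rewrite resK; congr (_ * _)%:E.
by apply: indic_iff; rewrite /A /= t2rvK.
Qed.

Definition gauss (e : 'rV[R]_d) : R := \prod_i normal_pdf 0 sigma (e 0 i).

Lemma gauss_ge0 e : 0 <= gauss e.
Proof. by apply: prodr_ge0 => i _; exact: normal_pdf_ge0. Qed.

Lemma continuous_gauss : continuous gauss.
Proof.
apply: continuous_bigprod => i e.
apply: (@continuous_comp _ _ _ (fun e : 'rV[R]_d => e 0 i) (normal_pdf 0 sigma)).
  exact: coord_continuous.
exact: continuous_normal_pdf.
Qed.

(** Independence and normality give a product of one-dimensional integrals, which [iint_prod]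
    reassembles. *)
Lemma noise_cube c e : 0 < e ->
  P (noise @^-1` (@t2rv R d @^-1` cube c e)) =
  iint (fun y => (\1_(cube c e) y * gauss y)%:E).
Proof.
move=> e0.
pose B i : set R := `]c 0 i - e, c 0 i + e[%classic.
have mB i : measurable (B i) by exact: measurable_itv.
have := indep finset.setT mB.
rewrite (_ : \big[setI/setT]_(i in _) _ = noise @^-1` (@t2rv R d @^-1` cube c e)); last first.
  rewrite (eq_bigl xpredT) => [|i]; last by rewrite finset.in_setT.
  rewrite -bigcap_seq; apply/seteqP; split=> w /=.
    by move=> Bw i; rewrite mxE tnth_mktuple; apply: Bw; rewrite /= mem_index_enum.
  by move=> Bw i _; have := Bw i; rewrite mxE tnth_mktuple.
move=> ->; rewrite (eq_bigl xpredT) => [|i]; last by rewrite finset.in_setT.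
under eq_bigr => i _ do rewrite normal// /normal_prob integral_mkcond.
under eq_iint => y.
  (* The factor 1 plays the part of the constant [k] of [iint_prod]. *)
  rewrite indic_cube -big_split/= -[X in X%:E]mul1r.
  over.
rewrite (iint_prod (g := fun i t => \1_(B i) t * normal_pdf 0 sigma t))//; last first.
- by move=> i t; rewrite mulr_ge0// normal_pdf_ge0.
- by move=> i; apply: measurable_funM => //; exact: measurable_normal_pdf.
rewrite mul1e; apply: eq_bigr => i _; apply: eq_integral => t _.
rewrite patchE indicE; case: ifPn => _; first by rewrite mul1r.
by rewrite mul0r.
Qed.

(** Both sides are continuous densities of the noise with equal integrals over cubes. Equality at
    every point, not just almost everywhere, is what allows [ln p] to be differentiated. *)
Lemma noise_density e : p (Phi e) = gauss e.
Proof.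
have cpPhi : continuous (p \o Phi).
  by move=> y; apply: continuous_comp; [exact: cPhi|exact: cp].
have cubes c r : 0 < r -> iint (fun y => (\1_(cube c r) y * (p \o Phi) y)%:E) =
    iint (fun y => (\1_(cube c r) y * gauss y)%:E).
  move=> r0; rewrite -noise_cube// noise_law.
    apply: eq_iint => y /=; congr (_ * _)%:E.
    by apply: indic_iff; rewrite /= t2rvK.
  exact: measurable_cube.
apply/eqP; rewrite eq_le; apply/andP; split.
  apply: (@continuous_le_of_cubes _ _ gauss (p \o Phi)) => //.
  - exact: continuous_gauss.
  - exact: gauss_ge0.
  - by move=> r r0; rewrite cubes.
apply: (@continuous_le_of_cubes _ _ (p \o Phi) gauss) => //.
- exact: continuous_gauss.
- by move=> y; exact: p_ge0.
- by move=> r r0; rewrite cubes.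
Qed.

End noise_law.

(** * Transfer of integrals between random variables with the same law *)

Section equal_laws.
Variables (R : realType) (dT dU : measure_display) (Omega : measurableType dT).
Variables (T : measurableType dU) (P : probability Omega R) (U V : Omega -> T).
Hypotheses (mU : measurable_fun setT U) (mV : measurable_fun setT V).
Hypothesis UV : forall B, measurable B -> P (U @^-1` B) = P (V @^-1` B).

Lemma eq_law_ge0_integral (k : T -> \bar R) : (forall t, 0 <= k t)%E ->
  measurable_fun setT k -> (\int[P]_w k (U w) = \int[P]_w k (V w))%E.
Proof.
move=> k0 mk.
have := ge0_integral_pushforward mU P measurableT mk (fun y _ => k0 y).
rewrite preimage_setT => <-.
have := ge0_integral_pushforward mV P measurableT mk (fun y _ => k0 y).
rewrite preimage_setT => <-.
pose PV := measure_function_pushforward__canonical__measure_function_Measure P mV.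
apply: (eq_measure_integral PV) => B mB _; exact: UV.
Qed.

Lemma eq_law_integrable (h : T -> R) : measurable_fun setT h ->
  P.-integrable setT (fun w => (h (U w))%:E) ->
  P.-integrable setT (fun w => (h (V w))%:E).
Proof.
move=> mh /integrableP[_ hoo]; apply/integrableP; split.
  by apply/measurable_EFinP; exact: (measurableT_comp mh mV).
rewrite -(@eq_law_ge0_integral (fun t => `|(h t)%:E|%E))//.
by apply: measurableT_comp => //; exact/measurable_EFinP.
Qed.

(** The positive and negative parts are transferred separately by the nonnegative case. *)
Lemma eq_law_Rintegral (h : T -> R) : measurable_fun setT h ->
  Rintegral P setT (h \o V) = Rintegral P setT (h \o U).
Proof.
move=> mh; congr fine; rewrite integralE [RHS]integralE.
have mEh : measurable_fun setT (EFin \o h) by exact/measurable_EFinP.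
have Ep := @eq_law_ge0_integral _ (funepos_ge0 _) (measurable_funepos mEh).
have En := @eq_law_ge0_integral _ (funeneg_ge0 _) (measurable_funeneg mEh).
have posE (W : Omega -> T) := funepos_comp (EFin \o h) W.
have negE (W : Omega -> T) := funeneg_comp (EFin \o h) W.
by rewrite !posE !negE Ep En.
Qed.

End equal_laws.

(** * Sign flips of the noise and the vanishing mean *)

Section noise_symmetry.
Variables (R : realType) (dT : measure_display) (Omega : measurableType dT).
Variables (P : probability Omega R) (d : nat) (adj : rel 'I_d).
Variables (f : 'I_d -> 'rV[R]_d -> R) (eps : 'I_d -> Omega -> R).
Variables (X : Omega -> 'rV[R]_d) (sigma : R) (p : 'rV[R]_d -> R).
Variable Phi : 'rV[R]_d -> 'rV[R]_d.
Hypothesis acyc : acyclic adj.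
Hypothesis dep : forall i, depends_only_on_parents adj i (f i).
Hypothesis cf : forall i, continuous (f i).
Hypothesis sigma_neq0 : sigma != 0.
Hypothesis meps : forall i, measurable_fun setT (eps i).
Hypothesis indep : mutually_independent P eps.
Hypothesis normal : forall i, is_centered_normal P (eps i) sigma.
Hypothesis XE : forall w, residual f finset.setT (X w) = \row_i eps i w.
Hypothesis dens : is_joint_density P X p.
Hypothesis cp : continuous p.
Hypothesis cPhi : continuous Phi.
Hypothesis PhiK : cancel Phi (residual f finset.setT).
Hypothesis resK : cancel (residual f finset.setT) Phi.

Definition flip n (k : 'I_n) (e : 'rV[R]_n) := upd k (- e 0 k) e.

Lemma continuous_flip n (k : 'I_n) : continuous (flip k).
Proof.
apply: (@continuous_upd _ _ k (fun e => - e 0 k)) => e.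
by apply: continuousN; exact: coord_continuous.
Qed.

Lemma gauss_flip (k : 'I_d) (e : 'rV[R]_d) : gauss sigma (flip k e) = gauss sigma e.
Proof.
apply: eq_bigr => i _; rewrite mxE; case: eqP => // ->.
by rewrite !normal_pdfE// /normal_fun !subr0 sqrrN.
Qed.

Lemma measurable_flip (k : 'I_d) :
  measurable_fun setT (@rv2t R d \o flip k \o @t2rv R d).
Proof.
apply/measurable_fun_tnthP => i.
have := continuous_rv_measurable (@continuous_flip _ k) i.
by congr measurable_fun; apply/funext => u /=; rewrite tnth_mktuple.
Qed.

Lemma measurable_noise : measurable_fun setT (noise eps).
Proof.
apply/measurable_fun_tnthP => i; rewrite (_ : _ \o _ = eps i)//.
by apply/funext => w /=; rewrite tnth_mktuple.
Qed.

(** The density [gauss] is even in each coordinate, and reflecting one coordinate preserves Lebesgue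
    measure. *)
Lemma flip_law (k : 'I_d) (B : set (d.-tuple R)) : measurable B ->
  P (noise eps @^-1` B) =
  P ((@rv2t R d \o flip k \o @t2rv R d \o noise eps) @^-1` B).
Proof.
move=> mB; rewrite (comp_preimage _ (noise eps)).
have law := noise_law acyc dep cf XE dens cp cPhi resK.
rewrite law// law; last first.
  by rewrite -[X in measurable X]setTI; exact: measurable_flip.
have nd := noise_density acyc dep cf sigma_neq0 indep normal XE dens cp cPhi resK.
under eq_iint do rewrite nd.
under [RHS]eq_iint do rewrite nd.
rewrite -[LHS](@iint_upd R d k (fun y => - y 0 k)).
- apply: eq_iint => e /=; rewrite -/(flip k e) gauss_flip; congr (_ * _)%:E.
  by apply: indic_iff; rewrite /= t2rvK.
- by move=> y; rewrite lee_fin mulr_ge0// gauss_ge0.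
- apply/measurable_EFinP; apply: measurable_funM.
    rewrite (_ : (fun _ => _) = \1_B); first exact: measurable_indic.
    by apply/funext => u /=; rewrite rv2tK.
  by apply: (@continuous_measurable_rV R d (gauss sigma)); exact: continuous_gauss.
- apply: (@continuous_measurable_rV R d (fun y => - y 0 k)) => e.
  by apply: continuousN; exact: coord_continuous.
- by move=> y; under eq_fun do rewrite updE; exact: lebesgue_preserving_opp.
Qed.

Lemma continuous_bigsum (T : topologicalType) (I : Type) (s : seq I) (Q : pred I)
    (h : I -> T -> R) : (forall i, continuous (h i)) ->
  continuous (fun x => \sum_(i <- s | Q i) h i x).
Proof.
move=> ch; elim: s => [|i s IH].
  by under eq_fun do rewrite big_nil; exact: cst_continuous.
under eq_fun do rewrite big_cons; case: (Q i); last exact: IH.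
by move=> x; apply: continuousD; [exact: ch|exact: IH].
Qed.

Let E w : 'rV[R]_d := \row_i eps i w.

Lemma flip_integral (k : 'I_d) (h : 'rV[R]_d -> R) : continuous h ->
  P.-integrable setT (fun w => (h (E w))%:E) ->
  P.-integrable setT (fun w => (h (flip k (E w)))%:E) /\
  Rintegral P setT (fun w => h (flip k (E w))) = Rintegral P setT (fun w => h (E w)).
Proof.
move=> ch; have mh := continuous_measurable_rV ch.
have nE w : t2rv (noise eps w) = E w.
  by apply/rowP => i; rewrite !mxE tnth_mktuple.
have mN := measurable_noise.
have mF : measurable_fun setT (@rv2t R d \o flip k \o @t2rv R d \o noise eps).
  by apply: measurableT_comp => //; exact: measurable_flip.
have -> : (fun w => (h (E w))%:E) = (fun w => ((h \o @t2rv R d) (noise eps w))%:E).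
  by apply/funext => w /=; rewrite nE.
have -> : (fun w => (h (flip k (E w)))%:E) = (fun w =>
   ((h \o @t2rv R d) ((@rv2t R d \o flip k \o @t2rv R d \o noise eps) w))%:E).
  by apply/funext => w /=; rewrite t2rvK nE.
move=> ih; split; first exact: (eq_law_integrable mN mF (flip_law k) mh ih).
have := eq_law_Rintegral mN mF (flip_law k) mh.
congr (_ = _); congr Rintegral; apply/funext => w /=; first by rewrite t2rvK nE.
by rewrite nE.
Qed.

Variable g : 'I_d -> 'rV[R]_d -> R.
Hypothesis depg : forall i, depends_only_on_parents adj i (g i).
Hypothesis cg : forall i, continuous (g i).

(** Applied with [g j] the second derivative of [f j] in a fixed direction, this is the noise term
    of the Hessian, written as a function of the noise alone. *)
Definition weighted_noise (S : {set 'I_d}) (e : 'rV[R]_d) : R :=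
  \sum_(j in S) e 0 j * g j (Phi e).

Lemma continuous_weighted_noise S : continuous (weighted_noise S).
Proof.
apply: continuous_bigsum => j e; apply: continuousM; first exact: coord_continuous.
by apply: continuous_comp; [exact: cPhi|exact: cg].
Qed.

Lemma weighted_noise_flip (S : {set 'I_d}) i e : parent_closed adj S -> i \in S ->
  (forall j, j \in S -> ~~ adj i j) ->
  weighted_noise (S :\ i) e =
  2^-1 * (weighted_noise S e + weighted_noise S (flip i e)).
Proof.
move=> pS iS sink.
(* This includes [j = i]: the parents of any node of [S] lie in [S :\ i], where the flip is not
   felt. Only the factor [e 0 i] changes. *)
have gE j : j \in S -> g j (Phi (flip i e)) = g j (Phi e).
  move=> jS; apply: depg => k kj.
  apply: (residual_inv_upd acyc dep PhiK _ _ pS sink).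
  rewrite in_setD1 (pS _ _ kj jS) andbT.
  by apply: contraTneq kj => ->; exact: sink.
rewrite /weighted_noise !(big_setD1 i iS)/= gE// updE.
rewrite [X in _ + (_ + X)](eq_bigr (fun j => e 0 j * g j (Phi e))) => [|j].
  by field.
by rewrite in_setD1 => /andP[ji jS]; rewrite gE// mxE (negbTE ji).
Qed.

(** Integrability is required of the whole sum only. It descends to [S :\ i], whose sum is the
    average of two integrable functions. *)
Lemma Rintegral_weighted_noise (S : {set 'I_d}) : parent_closed adj S ->
  P.-integrable setT (fun w => (weighted_noise S (E w))%:E) ->
  Rintegral P setT (fun w => weighted_noise S (E w)) = 0.
Proof.
move: S; apply: (sink_ind acyc) => [|S i pS iS sink IH] ih.
  rewrite /weighted_noise; under eq_Rintegral do rewrite big_set0.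
  by rewrite Rintegral_cst ?mul0r.
have [ih' hE] := flip_integral i (@continuous_weighted_noise S) ih.
pose a w := weighted_noise S (E w); pose b w := weighted_noise S (flip i (E w)).
have iab : P.-integrable setT (EFin \o (fun w => a w + b w)).
  exact: (integrableD measurableT ih ih').
have abE : (fun w => weighted_noise (S :\ i) (E w)) = (fun w => 2^-1 * (a w + b w)).
  by apply/funext => w; exact: weighted_noise_flip.
have : Rintegral P setT (fun w => weighted_noise (S :\ i) (E w)) = 0.
  apply: IH; rewrite -[fun w => _]/(EFin \o (fun w => weighted_noise (S :\ i) (E w))) abE.
  exact: (integrableZl measurableT 2^-1 iab).
(* Both functions have the same mean, so that of their average, zero by induction, is the mean
   sought. *)
rewrite abE RintegralZl// RintegralD// /b hE -/a.
by move=> H; lra.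
Qed.

End noise_symmetry.

(** * Hessian of the log-density *)

Section partial_derivatives.
Variables (R : realType) (d : nat) (adj : rel 'I_d).

Lemma evecE (i j : 'I_d) : evec R i 0 j = (j == i)%:R.
Proof. by rewrite mxE eqxx. Qed.

Lemma is_derive_coord (y v : 'rV[R]_d) j :
  is_derive y v (fun z : 'rV[R]_d => z 0 j) (v 0 j).
Proof.
have E : (fun h : R =>
    h^-1 *: ((fun z : 'rV[R]_d => z 0 j) (h *: v + y) - y 0 j)) @ 0^' --> v 0 j.
  apply: cvg_near_cst; near=> h.
  have h0 : h != 0 by near: h; exact: nbhs_dnbhs_neq.
  by rewrite !mxE addrK /GRing.scale/= mulKf.
apply: DeriveDef; first by apply/cvg_ex; exists (v 0 j); exact: E.
exact: cvg_lim E.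
Unshelve. all: by end_near. Qed.

(** A common shift keeps the points equal on the parents, so the difference quotients coincide
    before any limit is taken. *)
Lemma partial_depends (i j : 'I_d) (g : 'rV[R]_d -> R) :
  depends_only_on_parents adj j g -> depends_only_on_parents adj j (partial i g).
Proof.
move=> dg y z yz; rewrite /partial /derive.
rewrite (_ : (fun h => _) =
   (fun h : R => h^-1 *: ((g \o shift z) (h *: evec R i) - g z)))//.
apply/funext => h /=; congr (_ *: (_ - _)); last exact: dg.
by apply: dg => k kj; rewrite !mxE yz.
Qed.

Lemma partial_nonparent (i j : 'I_d) (g : 'rV[R]_d -> R) y :
  depends_only_on_parents adj j g -> ~~ adj i j -> partial i g y = 0.
Proof.
move=> dg nij; rewrite /partial /derive.
rewrite (_ : (fun h => _) = cst 0) ?lim_cst//.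
apply/funext => h /=; apply/eqP; rewrite scaler_eq0 subr_eq0.
apply/orP; right; apply/eqP; apply: dg => k kj; rewrite !mxE eqxx /=.
case: eqP => [ki|_]; last by rewrite mulr0 add0r.
by rewrite -ki kj in nij.
Qed.

End partial_derivatives.

Section log_density.
Variables (R : realType) (d : nat) (adj : rel 'I_d) (f : 'I_d -> 'rV[R]_d -> R).
Variable sigma : R.
Hypothesis acyc : acyclic adj.
Hypothesis dep : forall i, depends_only_on_parents adj i (f i).
Hypothesis C2f : forall i, C2 (f i).
Hypothesis sigma_gt0 : 0 < sigma.

(** The product is first written as one exponential, which [ln] then cancels. *)
Lemma ln_gauss (e : 'rV[R]_d) : ln (gauss sigma e) =
  \sum_j (ln (normal_peak sigma) - (2 * sigma ^+ 2)^-1 * e 0 j ^+ 2).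
Proof.
rewrite /gauss.
have -> : \prod_i normal_pdf 0 sigma (e 0 i) =
   expR (\sum_j (ln (normal_peak sigma) - (2 * sigma ^+ 2)^-1 * e 0 j ^+ 2)).
  rewrite expR_sum; apply: eq_bigr => i _.
  rewrite normal_pdfE ?gt_eqF// /normal_fun expRD lnK; last first.
    by rewrite posrE normal_peak_gt0 ?gt_eqF.
  by rewrite subr0 mulNr [_ / _]mulrC -[in LHS]mulr_natl.
by rewrite expRK.
Qed.

Let res j (y : 'rV[R]_d) := y 0 j - f j y.

Let der (i j : 'I_d) y : is_derive y (evec R i) (f j) (partial i (f j) y).
Proof. by apply: DeriveDef => //; have [_ + _ _ _] := C2f j; apply. Qed.

Let der2 (i j : 'I_d) y :
  is_derive y (evec R i) (partial i (f j)) (partial i (partial i (f j)) y).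
Proof. by apply: DeriveDef => //; have [_ _ _ + _] := C2f j; apply. Qed.

Let der_res (i j : 'I_d) y :
  is_derive y (evec R i) (res j) ((j == i)%:R - partial i (f j) y).
Proof.
rewrite -evecE; apply: is_deriveB; [exact: is_derive_coord|exact: der].
Qed.

Lemma partial_sum (i : 'I_d) (h dh : 'I_d -> 'rV[R]_d -> R) y :
  (forall j, is_derive y (evec R i) (h j) (dh j y)) ->
  partial i (fun z => \sum_j h j z) y = \sum_j dh j y.
Proof.
move=> Dh; rewrite /partial (_ : (fun z => _) = \sum_j h j).
  by apply: derive_val; exact: is_derive_sum.
by apply/funext => z; rewrite fct_sumE.
Qed.

Lemma partial_ln_gauss (i : 'I_d) y :
  partial i (fun y => ln (gauss sigma (residual f finset.setT y))) y =
  \sum_j - sigma ^- 2 * (res j y * ((j == i)%:R - partial i (f j) y)).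
Proof.
rewrite (_ : (fun y => ln _) = fun y =>
  \sum_j (ln (normal_peak sigma) - (2 * sigma ^+ 2)^-1 * res j y ^+ 2)); last first.
  apply/funext => z; rewrite ln_gauss; apply: eq_bigr => j _.
  by rewrite mxE finset.in_setT.
apply: (partial_sum (dh := fun j y =>
  - sigma ^- 2 * (res j y * ((j == i)%:R - partial i (f j) y)))) => j.
rewrite (_ : (fun y => _) = cst (ln (normal_peak sigma)) -
    ((2 * sigma ^+ 2)^-1 *: (res j * res j))).
  have D := is_deriveM (der_res i j y) (der_res i j y).
  apply: is_derive_eq; rewrite /GRing.scale/=.
  by field; rewrite gt_eqF.
by apply/funext => z; rewrite expr2.
Qed.

Lemma partial2_ln_gauss (i : 'I_d) y :
  partial i (partial i (fun y => ln (gauss sigma (residual f finset.setT y)))) y =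
  - sigma ^- 2 * (1 + \sum_(j | adj i j) (partial i (f j) y) ^+ 2
     - \sum_j res j y * partial i (partial i (f j)) y).
Proof.
rewrite (funext (partial_ln_gauss i)).
(* Product rule for the residual times its own derivative, whose derivative is minus the second
   derivative of [f j]. *)
pose dh j y := - sigma ^- 2 * (((j == i)%:R - partial i (f j) y) ^+ 2 -
     res j y * partial i (partial i (f j)) y).
transitivity (\sum_j dh j y).
  apply: (partial_sum (dh := dh)) => j.
  rewrite (_ : (fun y => _) = - sigma ^- 2 *:
      (res j * (cst (j == i)%:R - partial i (f j)))); last first.
    by apply/funext.
  have D0 := is_deriveB (is_derive_cst ((j == i)%:R : R) y (evec R i)) (der2 i j y).
  have D := is_deriveM (der_res i j y) D0.
  apply: is_derive_eq; rewrite /GRing.scale/= /dh.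
  set a := (j == i)%:R - _; set b := partial i (partial i _) y.
  rewrite -[LHS]/(- sigma ^- 2 * (res j y * (0 - b) + a * a) : R).
  by ring.
rewrite -mulr_sumr big_split/= sumrN; congr (_ * (_ - _)).
(* No cross term arises: [i] is not its own child, so one of the two terms in the square is always
   zero. *)
have dE j : ((j == i)%:R - partial i (f j) y) ^+ 2 =
    (j == i)%:R + if adj i j then partial i (f j) y ^+ 2 else 0.
  case: ifPn => ij; last first.
    rewrite (partial_nonparent _ (@dep j) ij) addr0 subr0.
    by case: (j == i); rewrite ?expr1n ?expr0n.
  rewrite (_ : (j == i) = false) ?sub0r ?add0r ?sqrrN//.
  by apply: contraTF ij => /eqP ->; exact: acyclic_loopless.
rewrite (eq_bigr _ (fun j _ => dE j)) big_split/= -big_mkcond/=; congr (_ + _).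
by rewrite (bigD1 i)//= eqxx big1 ?addr0// => j /negbTE ->.
Qed.

End log_density.

(** * Expectation of the Hessian and characterization of sinks *)

Lemma integrable_Rintegral_sum (dT : measure_display) (T : measurableType dT) (R : realType)
    (mu : {measure set T -> \bar R}) (I : Type) (s : seq I) (Q : pred I)
    (h : I -> T -> R) :
  (forall i, mu.-integrable setT (fun w => (h i w)%:E)) ->
  mu.-integrable setT (fun w => (\sum_(i <- s | Q i) h i w)%:E) /\
  Rintegral mu setT (fun w => \sum_(i <- s | Q i) h i w) =
  \sum_(i <- s | Q i) Rintegral mu setT (h i).
Proof.
move=> ih; split.
  under eq_fun do rewrite -sumEFin.
  exact: integrable_sum.
rewrite /Rintegral; under eq_integral do rewrite -sumEFin.
rewrite integral_sum//.
rewrite sum_fine// => i _; exact: integrable_fin_num.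
Qed.

Theorem theorem3p1 (R : realType) (dT : measure_display)
  (Omega : measurableType dT) (P : probability Omega R)
  (d : nat) (adj : rel 'I_d) (f : 'I_d -> 'rV[R]_d -> R)
  (eps x : 'I_d -> {RV P >-> R}) (sigma : R) (p : 'rV[R]_d -> R) :
  acyclic adj ->
  (forall i, depends_only_on_parents adj i (f i)) ->
  (forall i, C2 (f i)) ->
  0 < sigma ->
  mutually_independent P (fun i => (eps i : Omega -> R)) ->
  (forall i, is_centered_normal P (eps i) sigma) ->
  (forall i w, x i w = f i (\row_j x j w) + eps i w) ->
  let X := fun w => \row_j x j w in
  is_joint_density P X p ->
  (forall y, 0 < p y) -> C2 p ->
  (forall i j, P.-integrable setT
     (fun w => (partial i (partial j (fun y => ln (p y))) (X w))%:E)) ->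
  (forall i j, P.-integrable setT
     (fun w => ((partial i (f j) (X w)) ^+ 2)%:E)) ->
  let I := SJIM P X p in
  (forall i, I i i = sigma ^-2 + sigma ^-2 *
      \sum_(j | adj i j) Rintegral P setT (fun w => (partial i (f j) (X w)) ^+ 2))
  /\
  ((forall i j, adj j i ->
      0 < Rintegral P setT (fun w => (partial j (f i) (X w)) ^+ 2)) ->
   forall l, ((forall i, I l l <= I i i) /\ I l l = sigma ^-2)
             <-> (forall j, ~~ adj l j)).
Proof.
move=> acyc dep C2f sigma_gt0 indep normal xE X dens p_gt0 C2p iH iS I.
have cf i : continuous (f i) by have [] := C2f i.
have sigma0 : sigma != 0 by rewrite gt_eqF.
have meps i : measurable_fun setT (eps i : Omega -> R) by exact: measurable_funPT.
have cp : continuous p by have [] := C2p.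
have XE w : residual f finset.setT (X w) = \row_i eps i w.
  by apply/rowP => i; rewrite !mxE finset.in_setT xE addrAC subrr add0r.
have [Phi [cPhi PhiK resK]] :=
  residual_inverse acyc dep cf (parent_closedT (adj := adj)).
have pE : p = fun y => gauss sigma (residual f finset.setT y).
  apply/funext => y; rewrite -{1}(resK y).
  exact: (noise_density acyc dep cf sigma0 indep normal XE dens cp cPhi resK).
have diag i : I i i = sigma ^-2 + sigma ^-2 *
    \sum_(j | adj i j) Rintegral P setT (fun w => (partial i (f j) (X w)) ^+ 2).
  pose g j := partial i (partial i (f j)).
  have depg j : depends_only_on_parents adj j (g j).
    by do 2 apply: partial_depends.
  have cg j : continuous (g j) by have [_ _ _ _] := C2f j; apply.
  pose A w := \sum_(j | adj i j) (partial i (f j) (X w)) ^+ 2.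
  pose B w := partial i (partial i (fun y => ln (p y))) (X w).
  (* At the noise of [X w], the state [Phi e] is [X w] itself. *)
  pose W w := weighted_noise Phi g finset.setT (\row_i eps i w).
  have BE w : B w = - sigma ^- 2 * (1 + A w - W w).
    rewrite /B pE (partial2_ln_gauss acyc dep C2f sigma_gt0); congr (_ * (_ - _)).
    rewrite /W -XE /weighted_noise; apply: eq_big => [j|j _].
      by rewrite finset.in_setT.
    by rewrite resK [residual _ _ _ _ _]mxE finset.in_setT.
  have [iA AE] := integrable_Rintegral_sum (index_enum _) (adj i) (iS i).
  have iB : P.-integrable setT (EFin \o B) := iH i i.
  have i1 : P.-integrable setT (EFin \o (fun=> 1 : R)) by exact: finite_measure_integrable_cst.
  (* Solving [BE] for [W] exhibits the noise sum as a combination of functions assumed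
     integrable. *)
  have WE : W = fun w => (1 + A w) + sigma ^+ 2 * B w.
    by apply/funext => w; rewrite BE; field.
  have i1A : P.-integrable setT (EFin \o (fun w => 1 + A w)).
    exact: (integrableD measurableT i1 iA).
  have iB2 : P.-integrable setT (EFin \o (fun w => sigma ^+ 2 * B w)).
    exact: (integrableZl measurableT (sigma ^+ 2) iB).
  have iW : P.-integrable setT (EFin \o W).
    by rewrite WE; exact: (integrableD measurableT i1A iB2).
  have := Rintegral_weighted_noise acyc dep cf sigma0 meps indep normal XE dens
    cp cPhi PhiK resK depg cg (parent_closedT (adj := adj)) iW.
  rewrite -[fun w => weighted_noise _ _ _ _]/W WE RintegralD// RintegralD// RintegralZl//.
  have -> : Rintegral P setT (fun=> 1) = 1.
    rewrite Rintegral_cst// mul1r. exact: (congr1 fine (probability_setT P)).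
  rewrite AE => E0.
  (* [E0] says that 1 plus the sum of expectations plus [sigma ^+ 2] times the mean of [B] is zero;
     the diagonal entry is minus that mean. *)
  rewrite /I /SJIM mxE -/B; set S := \sum_(j | _) _ in E0 *.
  apply: (mulfI (expf_neq0 2 sigma0)); rewrite mulrN.
  move/eqP: E0; rewrite addrC addr_eq0 => /eqP ->; rewrite opprK.
  by field.
split=> // pos l.
have term_ge0 i j : 0 <= Rintegral P setT (fun w => (partial i (f j) (X w)) ^+ 2).
  by apply: Rintegral_ge0 => w _; exact: sqr_ge0.
split=> [[_]|sink].
  (* The value [sigma ^-2] forces a sum of nonnegative expectations to vanish, hence each term,
     while a child of [l] would contribute a positive one. *)
  rewrite diag => /eqP; rewrite -subr_eq0 addrC addKr mulf_eq0.
  rewrite invr_eq0 expf_eq0 (negbTE sigma0)/= => /eqP S0 j; apply/negP => lj.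
  have := pos j l lj; rewrite lt_neqAle => /andP[/eqP + _]; apply.
  apply/esym; move: S0 => /eqP; rewrite psumr_eq0// => /allP/(_ j (mem_index_enum j)).
  by rewrite lj => /eqP.
have Il : I l l = sigma ^- 2.
  by rewrite diag big_pred0 ?mulr0 ?addr0// => j; exact/negbTE.
split=> // i; rewrite Il diag lerDl mulr_ge0 ?invr_ge0 ?sqr_ge0//.
by apply: sumr_ge0.
Qed.
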